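(* Let $a$ and $b$ be nonzero coprime integers and let $k,T$ be integers with $0\le T<k$. Let $d>1$ be an odd integer such that $\gcd(d,ab)=1$. Then $d\in G_{(T,k)}(a,b)$ if and only if there exists a positive integer $\alpha$ satisfying the following conditions: (1) $\nu_2\bigl(\operatorname{ord}_p(ab^{-1})\bigr)=\alpha$ for every prime $p\mid d$; (2) $T\equiv 2^{\alpha-1}\pmod{2^{\min\{\alpha,\nu_2(k)\}}}$; (3) $\displaystyle \gcd\left(\frac{k}{2^{\nu_2(k)}},\ \frac{\operatorname{lcm}_{p^e\parallel d}\operatorname{ord}_{p^e}(ab^{-1})}{2^\alpha}\right)\ \Big|\ T$.
   Context: For nonzero coprime integers $a,b$ and integers $0\le T<k$, $G_{(T,k)}(a,b)$ denotes the set of positive integers $d$ such that $d\mid (a^{ks+T}+b^{ks+T})$ for some positive integer $s$. For a positive integer $m$ with $\gcd(m,ab)=1$, $\operatorname{ord}_m(ab^{-1})$ is the multiplicative order modulo $m$ of the residue class $ab^{-1}$, where $b^{-1}$ is the inverse of $b$ modulo $m$. $\nu_2(i)$ is the $2$-adic valuation of a nonzero integer $i$. If $d=\prod_{i=1}^m p_i^{e_i}$ is the factorization of $d$ into powers of distinct primes (with $e_i\ge1$), then $\operatorname{lcm}_{p^e\parallel d}\operatorname{ord}_{p^e}(ab^{-1})$ means $\operatorname{lcm}\bigl(\operatorname{ord}_{p_1^{e_1}}(ab^{-1}),\dots,\operatorname{ord}_{p_m^{e_m}}(ab^{-1})\bigr)$. *)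

(* Defs.v *)
From mathcomp Require Import all_boot all_order all_algebra all_fingroup.

Set Implicit Arguments.
Unset Strict Implicit.
Unset Printing Implicit Defensive.

Import GRing.Theory.
Local Open Scope ring_scope.

Definition in_G (T k : nat) (a b : int) (d : nat) : Prop :=
  (0 < d)%N /\
  exists s : nat, (0 < s)%N /\
    (d%:Z %| a ^+ (k * s + T) + b ^+ (k * s + T))%Z.

(* ord_m(a b^-1), the order in the unit group of Z/m; meaningful when m is
   positive and coprime to a * b. If a / b is not a unit of 'Z_m, insubd falls
   back to the unit 1 and the value is 1. For m = 1, where 'Z_1 is Z/2, the
   value is 1, as it should be. *)
Definition ord_ratio (m : nat) (a b : int) : nat :=
  #[insubd (1%g : {unit 'Z_m}) (a%:~R / b%:~R)%R]%g.

Definition lcm_ord_ratio (d : nat) (a b : int) : nat :=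
  \big[lcmn/1%N]_(p <- primes d) ord_ratio (p ^ logn p d) a b.

(* Main.v *)
Require Import Defs.
From mathcomp Require Import all_boot all_order all_algebra all_fingroup.
From mathcomp Require Import cyclic ring.

Set Implicit Arguments.
Unset Strict Implicit.
Unset Printing Implicit Defensive.

Import GRing.Theory.
Local Open Scope ring_scope.

(** Write [x] for the class of [a / b]. Modulo an odd prime power [q = p ^ e],
    the only square roots of 1 are 1 and -1, since [p] cannot divide both
    [y - 1] and [y + 1]. Hence [q] divides [a ^ n + b ^ n], that is
    [x ^ n = -1], exactly when the order [o] of [x] modulo [q] divides [2 * n]
    but not [n] ([prime_pow_dvd_sum_iff]). When this happens, the 2-adic
    valuation of [o] is one more than that of [n]
    ([logn_eq_succ_of_dvd_prime_mul]).

    So if [d] divides [a ^ n + b ^ n], the orders modulo all the prime powers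
    exactly dividing [d] share one valuation [alpha > 0], which is also their
    valuation modulo the primes ([logn2_ord_ratio_prime_pow]). Conversely, when
    the valuations agree, the conditions on the separate orders merge into one
    on their least common multiple [L]: it divides [2 * n] but not [n]
    ([dvd_sum_iff_lcm_ord]). This says that [n] is congruent to [L / 2] modulo
    [L] ([dvdn_double_half_mod]).

    It remains to ask for which [T] some [n = k * s + T] with [s > 0] is in
    that class. This is a linear congruence, solvable exactly when
    [T] is congruent to [L / 2] modulo [gcdn k L]
    ([linear_congruence_solvable]). Splitting that gcd into its 2-part
    [2 ^ minn alpha (logn 2 k)] and its odd part turns this congruence into the
    last two conditions of the theorem ([eq_half_mod_gcd_iff]): the odd part
    divides [L / 2], and [L / 2] is [2 ^ (alpha - 1)] times an odd number. *)

(** * Valuations and congruences of natural numbers *)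

(** If [logn p o] were at most [logn p n], the [p]-part of [o] would divide
    [n]; its [p^']-part divides [n] in any case. *)
Lemma logn_eq_succ_of_dvd_prime_mul (p o n : nat) :
  prime p -> (0 < n)%N -> (o %| p * n)%N -> ~~ (o %| n)%N ->
  logn p o = (logn p n).+1.
Proof.
move=> p_pr n_gt0 o_dvd_pn oNn.
have p_gt0 := prime_gt0 p_pr.
have pn_gt0 : (0 < p * n)%N by rewrite muln_gt0 p_gt0.
have o_gt0 : (0 < o)%N by apply: dvdn_gt0 o_dvd_pn.
have le_log := dvdn_leq_log p pn_gt0 o_dvd_pn.
rewrite lognM // (logn_prime p p_pr) eqxx add1n in le_log.
apply/eqP; rewrite eqn_leq le_log ltnNge; apply: contra oNn => log_le.
rewrite -(partnC p o_gt0) Gauss_dvd ?coprime_partC //.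
rewrite p_part pfactor_dvdn // log_le /=.
have cop : coprime o`_p^' p.
  by rewrite coprime_sym prime_coprime // -p'natE // part_pnat.
by rewrite -(Gauss_dvdr n cop) (dvdn_trans (dvdn_part _ _) o_dvd_pn).
Qed.

Lemma dvdn_double_half_mod (h n : nat) : (0 < h)%N ->
  ((2 * h %| 2 * n) && ~~ (2 * h %| n))%N = (n == h %[mod 2 * h])%N.
Proof.
move=> h_gt0; rewrite dvdn_pmul2l //.
apply/andP/eqP => [[/dvdnP[m ->]]|n_mod].
  rewrite dvdn_pmul2r // dvdn2 negbK => m_odd.
  rewrite -(odd_double_half m) m_odd mulnDl mul1n -muln2 -mulnA addnC.
  by rewrite modnMDl.
split.
  by rewrite /dvdn -(modn_dvdm n (dvdn_mull 2 (dvdnn h))) n_mod modn_dvdm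
             ?dvdn_mull // modnn.
by rewrite /dvdn n_mod modn_small ?ltn_Pmull // -lt0n.
Qed.

(** Positivity of [s] costs nothing, since [L] may be added to any solution. *)
Lemma linear_congruence_solvable (k L T c : nat) : (0 < L)%N ->
  (exists s, (0 < s)%N /\ (k * s + T = c %[mod L])%N) <->
  (T = c %[mod gcdn k L])%N.
Proof.
move=> L_gt0; split=> [[s [_ eq_s]]|eq_T].
  rewrite -(modn_dvdm c (dvdn_gcdr k L)) -eq_s modn_dvdm ?dvdn_gcdr //.
  by rewrite -modnDml (eqP (dvdn_mulr s (dvdn_gcdl k L))).
have [u _ /dvdnP[v eq_uv]] := Bezoutr k L_gt0.
(* Adding [L * T] to [c] keeps its class and makes the subtraction of [T]
   exact. *)
have [m eq_m] : exists m, (c + L * T = m * gcdn k L + T)%N.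
  have leT : (T <= c + L * T)%N.
    by rewrite (leq_trans (leq_pmull T L_gt0)) ?leq_addl.
  have /dvdnP[m eq_m] : (gcdn k L %| c + L * T - T)%N.
    rewrite -eqn_mod_dvd // -modnDmr.
    by rewrite (eqP (dvdn_mulr T (dvdn_gcdr k L))) addn0 eq_T.
  by exists m; rewrite -eq_m subnK.
(* [u] inverts [k] up to the factor [- gcdn k L], and [L.-1] stands for -1. *)
exists (m * u * L.-1 + L)%N; split; first by rewrite addn_gt0 L_gt0 orbT.
have -> : (c = c + L * T %[mod L])%N by rewrite addnC mulnC modnMDl.
rewrite eq_m.
rewrite -(modnMDl (m * gcdn k L)) addnA.
have -> : (m * gcdn k L * L + k * (m * u * L.-1 + L) + T =
  (m * L.-1 * v + k) * L + (m * gcdn k L + T))%N.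
  case: L L_gt0 eq_uv {eq_T eq_m} => // L _; move: (gcdn k L.+1) => g /= eq_uv.
  have -> : ((m * L * v + k) * L.+1 = m * L * (v * L.+1) + k * L.+1)%N by ring.
  by rewrite -eq_uv; ring.
by rewrite modnMDl.
Qed.

(** * Orders of [a / b] modulo an integer *)

Lemma ord_ratio_gt0 m a b : (0 < ord_ratio m a b)%N.
Proof. exact: order_gt0. Qed.

Lemma intr_Zp_eq0 (m : nat) (z : int) : (1 < m)%N ->
  (z%:~R == 0 :> 'Z_m) = (m %| z)%Z.
Proof.
move=> m_gt1; have natE (n : nat) : (n%:R == 0 :> 'Z_m) = (m %| n)%N.
  by rewrite -val_eqE /= val_Zp_nat.
by case: z => n; rewrite ?NegzE ?mulrNz ?oppr_eq0 natE dvdzE //= abszN.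
Qed.

Lemma intr_Zp_unit (m : nat) (z : int) : (1 < m)%N -> coprimez m z ->
  (z%:~R : 'Z_m) \is a GRing.unit.
Proof.
move=> m_gt1; rewrite /coprimez /gcdz.
by case: z => n; rewrite ?NegzE ?mulrNz ?unitrN ?abszN /= unitZpE.
Qed.

Lemma ord_ratio_dvdn (m n : nat) (a b : int) :
  (1 < m)%N -> coprimez m (a * b) ->
  (ord_ratio m a b %| n)%N = (m %| a ^+ n - b ^+ n)%Z.
Proof.
move=> m_gt1; rewrite coprimezMr => /andP[cop_a cop_b].
have a_unit := intr_Zp_unit m_gt1 cop_a.
have b_unit := intr_Zp_unit m_gt1 cop_b.
rewrite /ord_ratio order_dvdn -val_eqE /=.
rewrite FinRing.val_unitX val_insubd unitrM a_unit unitrV b_unit /=.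
rewrite -intr_Zp_eq0 // rmorphB !rmorphXn /= expr_div_n subr_eq0.
by rewrite -[LHS](inj_eq (mulIr (unitrX n b_unit))) divrK ?unitrX // mul1r.
Qed.

(** The product [(a ^ n - b ^ n) * (a ^ n + b ^ n)] is [a ^ (2 * n) - b ^ (2 * n)],
    and [p] divides at most one of the two factors, as it would otherwise divide
    [2 * a ^ n]. So the whole prime power falls in one factor. *)
Lemma prime_pow_dvd_sum_iff (p e n : nat) (a b : int) :
  prime p -> odd p -> (0 < e)%N -> coprimez p (a * b) ->
  ((p ^ e)%N %| a ^+ n + b ^+ n)%Z =
  (ord_ratio (p ^ e) a b %| 2 * n)%N && ~~ (ord_ratio (p ^ e) a b %| n)%N.
Proof.
move=> p_pr p_odd e_gt0 cop_p.
set A := a ^+ n; set B := b ^+ n; set q := (p ^ e)%N.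
have q_gt1 : (1 < q)%N by rewrite -(expn0 p) ltn_exp2l ?prime_gt1.
have cop_q : coprimez q (a * b) by rewrite coprimezE coprimeXl.
have p_dvd_q : (p %| q)%N by rewrite dvdn_exp.
rewrite !ord_ratio_dvdn // mulnC !exprM -/A -/B subr_sqr.
have pNboth : ~~ ((p %| A - B)%Z && (p %| A + B)%Z).
  apply/negP => /andP[p_dvd_sub p_dvd_add].
  have : (p %| A * 2)%Z.
    have -> : A * 2 = (A - B) + (A + B) by ring.
    exact: rpredD.
  rewrite Gauss_dvdzl; last first.
    by rewrite coprimezE coprimen2.
  move: cop_p; rewrite coprimezMr => /andP[cop_a _] p_dvd_A.
  have := coprimezXr n cop_a.
  rewrite coprimezE /coprime (gcdn_idPl p_dvd_A) /= => /eqP p_1.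
  by rewrite p_1 in p_pr.
have coprime_of (z : int) : ~~ (p %| z)%Z -> coprimez q z.
  by move=> pNz; rewrite coprimezE coprimeXl // prime_coprime.
have p_of (z : int) : (q %| z)%Z -> (p %| z)%Z by apply: dvdz_trans.
apply/idP/andP => [q_dvd_add|[q_dvd_mul qNsub]].
  split; first exact: dvdz_mull.
  apply: contra pNboth => /p_of ->; exact: p_of.
have [p_dvd_add|pNadd] := boolP (p %| A + B)%Z; last first.
  by rewrite (Gauss_dvdzl _ (coprime_of _ pNadd)) (negPf qNsub) in q_dvd_mul.
rewrite p_dvd_add andbT in pNboth.
by rewrite (Gauss_dvdzr _ (coprime_of _ pNboth)) in q_dvd_mul.
Qed.

(** An even order [o] modulo [p ^ e] makes [p ^ e], hence [p], divide
    [a ^ (o / 2) + b ^ (o / 2)]. So the valuation of the order modulo [p] is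
    again one more than that of [o / 2]. *)
Lemma logn2_ord_ratio_prime_pow (p e : nat) (a b : int) :
  prime p -> odd p -> (0 < e)%N -> coprimez p (a * b) ->
  logn 2 (ord_ratio (p ^ e) a b) = logn 2 (ord_ratio p a b).
Proof.
move=> p_pr p_odd e_gt0 cop_p.
set o := ord_ratio (p ^ e) a b.
have o_gt0 : (0 < o)%N by apply: ord_ratio_gt0.
have q_gt1 : (1 < p ^ e)%N by rewrite -(expn0 p) ltn_exp2l ?prime_gt1.
have cop_q : coprimez (p ^ e)%N (a * b) by rewrite coprimezE coprimeXl.
have p_dvd_q : (p %| p ^ e)%N by rewrite dvdn_exp.
have op_dvd_o : (ord_ratio p a b %| o)%N.
  rewrite ord_ratio_dvdn ?prime_gt1 //.
  by apply: (@dvdz_trans (p ^ e)%N) => //; rewrite -ord_ratio_dvdn.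
have [o_odd|o_even] := boolP (odd o).
  by rewrite !logn_coprime ?coprime2n // (dvdn_odd op_dvd_o).
have o_def : o = (2 * o./2)%N by rewrite mul2n even_halfK.
have h_gt0 : (0 < o./2)%N by rewrite -double_gt0 -mul2n -o_def.
have oNh : ~~ (o %| o./2)%N.
  by rewrite gtnNdvd // [X in (_ < X)%N]o_def ltn_Pmull.
have : ((p ^ e)%N %| a ^+ o./2 + b ^+ o./2)%Z.
  by rewrite prime_pow_dvd_sum_iff // -o_def dvdnn.
move/(@dvdz_trans (p ^ e)%N p _ p_dvd_q).
rewrite -{1}(expn1 p) prime_pow_dvd_sum_iff // expn1 => /andP[op_dvd opNh].
rewrite (logn_eq_succ_of_dvd_prime_mul _ h_gt0 op_dvd) //.
by rewrite {1}o_def lognM // logn_prime.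
Qed.

(** * Least common multiples over a sequence *)

Lemma dvdn_biglcm_seqP (I : eqType) (s : seq I) (F : I -> nat) (n : nat) :
  reflect (forall i, i \in s -> (F i %| n)%N)
          (\big[lcmn/1%N]_(i <- s) F i %| n)%N.
Proof.
have -> : (\big[lcmn/1%N]_(i <- s) F i %| n)%N = all (fun i => F i %| n)%N s.
  by elim: s => [|i s IHs]; rewrite ?big_nil ?dvd1n // big_cons dvdn_lcm IHs.
exact: allP.
Qed.

Lemma logn_biglcm_const (I : eqType) (s : seq I) (F : I -> nat) (p v : nat) :
  s != [::] ->
  (forall i, i \in s -> (0 < F i)%N /\ logn p (F i) = v) ->
  (0 < \big[lcmn/1%N]_(i <- s) F i)%N /\
  logn p (\big[lcmn/1%N]_(i <- s) F i) = v.
Proof.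
elim: s => // i [|j s] IHs _ Fs; rewrite big_cons.
  by rewrite big_nil lcmn1; apply: Fs; rewrite mem_head.
have [Fi_gt0 Fi_v] := Fs i (mem_head i _).
have [|l sl|L_gt0 L_v] := IHs; [by [] | by apply: Fs; rewrite inE sl orbT |].
by rewrite lcmn_gt0 Fi_gt0 L_gt0 logn_lcm // Fi_v L_v maxnn.
Qed.

(** * The residue of half the least common multiple *)

Lemma partn2CE n : (0 < n)%N -> (n %/ 2 ^ logn 2 n)%N = (n`_2^')%N.
Proof.
by move=> n_gt0; rewrite -{1}(partnC 2%N n_gt0) -p_part mulKn ?part_gt0.
Qed.

(** The number [2 ^ (alpha - 1) * (L %/ 2 ^ alpha)] is [L / 2]. Modulo the 2-part
    of [gcdn k L] its odd factor can be dropped, because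
    [2 ^ (alpha - 1) * 2] is 0 there; modulo the odd part it vanishes. The
    Chinese remainder theorem separates the two. *)
Lemma eq_half_mod_gcd_iff (k L T alpha : nat) :
  (0 < k)%N -> (0 < L)%N -> (0 < alpha)%N -> logn 2 L = alpha ->
  (T = 2 ^ (alpha - 1) * (L %/ 2 ^ alpha) %[mod gcdn k L])%N <->
  (T = 2 ^ (alpha - 1) %[mod 2 ^ minn alpha (logn 2 k)])%N /\
  (gcdn (k %/ 2 ^ logn 2 k) (L %/ 2 ^ alpha) %| T)%N.
Proof.
move=> k_gt0 L_gt0 alpha_gt0 log_L.
have L'E : (L %/ 2 ^ alpha = L`_2^')%N by rewrite -log_L partn2CE.
have g_gt0 : (0 < gcdn k L)%N by rewrite gcdn_gt0 k_gt0.
have -> : (gcdn k L = 2 ^ minn alpha (logn 2 k) *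
             gcdn (k %/ 2 ^ logn 2 k) (L %/ 2 ^ alpha))%N.
  rewrite L'E partn2CE // -partn_gcd // -{1}(partnC 2%N g_gt0) p_part.
  by rewrite logn_gcd // log_L minnC.
have odd_L' : odd (L %/ 2 ^ alpha).
  by rewrite L'E -[odd _]negbK -dvdn2 -p'natE // part_pnat.
have /chinese_remainder crt : coprime (2 ^ minn alpha (logn 2 k))
    (gcdn (k %/ 2 ^ logn 2 k) (L %/ 2 ^ alpha)).
  by rewrite coprimeXl // coprime2n (dvdn_odd (dvdn_gcdr _ _)).
have half_mod : (2 ^ (alpha - 1) * (L %/ 2 ^ alpha) = 2 ^ (alpha - 1)
    %[mod 2 ^ minn alpha (logn 2 k)])%N.
  have dvd_alpha := dvdn_exp2l 2 (geq_minl alpha (logn 2 k)).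
  rewrite -(odd_double_half (L %/ 2 ^ alpha)) odd_L' mulnDr muln1 -mul2n.
  rewrite mulnA -expnSr subn1 prednK // -modnDmr.
  by rewrite (eqP (dvdn_mulr _ dvd_alpha)) addn0.
have zero_mod : (2 ^ (alpha - 1) * (L %/ 2 ^ alpha) %%
    gcdn (k %/ 2 ^ logn 2 k) (L %/ 2 ^ alpha) = 0)%N.
  by apply/eqP/dvdn_mull/dvdn_gcdr.
split=> [/eqP|[eq_T dvd_T]].
  by rewrite crt half_mod zero_mod => /andP[/eqP].
by apply/eqP; rewrite crt half_mod zero_mod eq_T eqxx.
Qed.

(** * Divisors of [a ^ n + b ^ n] *)

Section OddModulus.

Variables (a b : int) (d : nat).
Hypotheses (d_gt1 : (1 < d)%N) (odd_d : odd d).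
Hypothesis coprime_d_ab : coprimez d (a * b).

Let prime_divisorP (p : nat) : p \in primes d ->
  [/\ prime p, (p %| d)%N, odd p, (0 < logn p d)%N & coprimez p (a * b)].
Proof.
rewrite mem_primes => /and3P[p_pr d_gt0 p_dvd_d].
split=> //; first exact: dvdn_odd p_dvd_d odd_d.
  by rewrite logn_gt0 mem_primes p_pr d_gt0.
exact: coprimez_dvdl p_dvd_d coprime_d_ab.
Qed.

Lemma logn2_lcm_ord_ratio (alpha : nat) :
  (forall p : nat, prime p -> (p %| d)%N -> logn 2 (ord_ratio p a b) = alpha) ->
  (0 < lcm_ord_ratio d a b)%N /\ logn 2 (lcm_ord_ratio d a b) = alpha.
Proof.
move=> log_p; apply: logn_biglcm_const => [|p /prime_divisorP[p_pr p_dvd ? ? ?]].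
  have : pdiv d \in primes d by rewrite mem_primes pdiv_prime // pdiv_dvd ltnW.
  by apply: contraTneq => ->.
by split; [exact: ord_ratio_gt0 | rewrite logn2_ord_ratio_prime_pow // log_p].
Qed.

Lemma dvd_sum_iff_ord_prime_pow (n : nat) :
  (d %| a ^+ n + b ^+ n)%Z <->
  (forall p, p \in primes d ->
     (ord_ratio (p ^ logn p d) a b %| 2 * n)%N &&
     ~~ (ord_ratio (p ^ logn p d) a b %| n)%N).
Proof.
rewrite dvdzE /=; split=> [/(dvdn_partP _ (ltnW d_gt1)) d_dvd p p_d|ords].
  have [p_pr _ p_odd e_gt0 cop_p] := prime_divisorP p_d.
  by rewrite -prime_pow_dvd_sum_iff // dvdzE /= -p_part d_dvd.
apply/(dvdn_partP _ (ltnW d_gt1)) => p p_d.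
have [p_pr _ p_odd e_gt0 cop_p] := prime_divisorP p_d.
have := ords p p_d.
by rewrite -prime_pow_dvd_sum_iff // dvdzE /= -p_part.
Qed.

(** Only equality of the valuations lets the lcm speak for the separate orders:
    if some order [o] divided [n], then [logn 2 n] would be at least
    [logn 2 o = logn 2 L], which is [(logn 2 n).+1]. *)
Lemma dvd_sum_iff_lcm_ord (n : nat) : (0 < n)%N ->
  (d %| a ^+ n + b ^+ n)%Z <->
  exists alpha : nat,
    [/\ (0 < alpha)%N,
        forall p : nat, prime p -> (p %| d)%N ->
          logn 2 (ord_ratio p a b) = alpha &
        (lcm_ord_ratio d a b %| 2 * n)%N && ~~ (lcm_ord_ratio d a b %| n)%N].
Proof.
move=> n_gt0; rewrite dvd_sum_iff_ord_prime_pow.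
have p0_d : pdiv d \in primes d.
  by rewrite mem_primes pdiv_prime // pdiv_dvd ltnW.
split=> [ords|[alpha [alpha_gt0 log_p /andP[L_dvd LNdvd]]] p p_d].
  exists (logn 2 n).+1; split=> // [p p_pr p_dvd|].
    have p_d : p \in primes d by rewrite mem_primes p_pr p_dvd ltnW.
    have [_ _ p_odd e_gt0 cop_p] := prime_divisorP p_d.
    rewrite -(logn2_ord_ratio_prime_pow p_pr p_odd e_gt0 cop_p).
    by have /andP[] := ords p p_d; apply: logn_eq_succ_of_dvd_prime_mul.
  apply/andP; split.
    by apply/dvdn_biglcm_seqP => p /ords/andP[].
  have /andP[_] := ords _ p0_d; apply: contra.
  by move/dvdn_biglcm_seqP; apply.
have [p_pr p_dvd p_odd e_gt0 cop_p] := prime_divisorP p_d.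
have [L_gt0 log_L] := logn2_lcm_ord_ratio log_p.
have := logn_eq_succ_of_dvd_prime_mul (isT : prime 2) n_gt0 L_dvd LNdvd.
rewrite log_L => log_n; apply/andP; split.
  by move/dvdn_biglcm_seqP: L_dvd; apply.
apply/negP => /(dvdn_leq_log 2 n_gt0).
by rewrite logn2_ord_ratio_prime_pow // log_p // log_n ltnn.
Qed.

End OddModulus.

(* In the last condition the quotients by powers of 2 are exact, the second
   one because of the condition on the orders modulo the primes dividing d. *)
Theorem theorem9 (a b : int) (k T d : nat)
    (a_neq0 : a <> 0) (b_neq0 : b <> 0) (coprime_ab : coprimez a b)
    (ltTk : (T < k)%N) (d_gt1 : (1 < d)%N) (odd_d : odd d)
    (coprime_d_ab : coprimez d%:Z (a * b)) :
  in_G T k a b d <->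
  exists alpha : nat,
    [/\ (0 < alpha)%N,
        forall p : nat, prime p -> (p %| d)%N ->
          logn 2 (ord_ratio p a b) = alpha,
        (T = 2 ^ (alpha - 1) %[mod 2 ^ minn alpha (logn 2 k)])%N &
        (gcdn (k %/ 2 ^ logn 2 k) (lcm_ord_ratio d a b %/ 2 ^ alpha) %| T)%N].
Proof.
have k_gt0 : (0 < k)%N by apply: leq_ltn_trans ltTk.
have exponent_gt0 s : (0 < s)%N -> (0 < k * s + T)%N.
  by move=> s_gt0; rewrite addn_gt0 muln_gt0 k_gt0 s_gt0.
set L := lcm_ord_ratio d a b.
have exponent_half alpha n : (0 < alpha)%N -> (0 < L)%N -> logn 2 L = alpha ->
    ((L %| 2 * n) && ~~ (L %| n))%N =
    (n == 2 ^ (alpha - 1) * (L %/ 2 ^ alpha) %[mod L])%N.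
  move=> alpha_gt0 L_gt0 log_L.
  set h := (2 ^ (alpha - 1) * (L %/ 2 ^ alpha))%N.
  have L_def : L = (2 * h)%N.
    rewrite /h mulnA -expnS subn1 prednK // -log_L partn2CE // -p_part.
    by rewrite partnC.
  rewrite [in LHS]L_def [in RHS]L_def; apply: dvdn_double_half_mod.
  by rewrite -(ltn_pmul2l (isT : 0 < 2)%N) muln0 -L_def.
split=> [[_ [s [s_gt0 /dvd_sum_iff_lcm_ord]]]|[alpha [alpha_gt0 log_p mod2 dvdT]]].
  case=> // [|alpha [alpha_gt0 log_p L_half]]; first exact: exponent_gt0.
  have [L_gt0 log_L] := logn2_lcm_ord_ratio d_gt1 odd_d coprime_d_ab log_p.
  exists alpha; rewrite -/L in L_half L_gt0 log_L *.
  rewrite (exponent_half alpha) // in L_half.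
  by case/(eq_half_mod_gcd_iff T k_gt0 L_gt0 alpha_gt0 log_L):
    (proj1 (linear_congruence_solvable k T _ L_gt0)
       (ex_intro _ s (conj s_gt0 (eqP L_half)))).
have [L_gt0 log_L] := logn2_lcm_ord_ratio d_gt1 odd_d coprime_d_ab log_p.
have /(linear_congruence_solvable _ _ _ L_gt0)[s [s_gt0 /eqP L_half]] :=
  proj2 (eq_half_mod_gcd_iff T k_gt0 L_gt0 alpha_gt0 log_L) (conj mod2 dvdT).
split; first exact: ltnW.
exists s; split=> //; apply/dvd_sum_iff_lcm_ord; rewrite ?exponent_gt0 //.
by exists alpha; split=> //; rewrite (exponent_half alpha).
Qed.
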